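(* Let $X$ be a locally compact, geodesically complete CAT(0)-space connected at infinity, let $a$ be a complete geodesic of strictly rank one and let $x_0\in a$ be an arbitrary point. Then $\delta(\xi,\eta,x)\to0$ as $(\xi,\eta,x)=(b(+\infty),c(-\infty),x)\in Z(a)$ tends to $(a(+\infty),a(-\infty),x_0)$ in the topology of $Z(a)$ induced from $\partial_\infty X\times\partial_\infty X\times X$.
   Context: Scissors $\langle a,b,c,d;x\rangle$: complete geodesics with $a(-\infty)=b(-\infty)$, $a(+\infty)=c(+\infty)$, $c(-\infty)=d(-\infty)$, $b(+\infty)=d(+\infty)$, $b\cap c=\{x\}$. For complete geodesics $c_1,c_2$ with a common ideal endpoint $\xi$, the metric transfer $R_{c_1c_2}(c_1(t))=c_2(t)$ uses arclength parametrizations with $\beta_\xi(c_1(t))=\beta_\xi(c_2(t))$, $\beta_\xi$ a Busemann function centred at $\xi$. The scissors translation is $T=R_{ba}\circ R_{db}\circ R_{cd}\circ R_{ac}\colon a\to a$, with displacement $\delta T=\beta_{a(-\infty)}(T(m))-\beta_{a(-\infty)}(m)$, $m\in a$. $Z(a)$ is the set of triples $(\xi,\eta,x)$ for which there are scissors $\langle a,b,c,d;x\rangle$ with $b(+\infty)=\xi$, $c(-\infty)=\eta$, and $\delta(\xi,\eta,x)$ is the displacement of such scissors. Strictly rank one: the geodesic does not virtually bound a flat strip. $\partial_\infty X$ carries the cone topology. *)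

(* Defs.v *)
From HB Require Import structures.
From mathcomp Require Import all_boot all_order all_algebra.
From mathcomp Require Import all_classical all_reals all_analysis.
Set Implicit Arguments. Unset Strict Implicit. Unset Printing Implicit Defensive.
Import Order.TTheory GRing.Theory Num.Theory.
Import numFieldNormedType.Exports.
Local Open Scope classical_set_scope.
Local Open Scope ring_scope.

Definition is_metric {R : realType} {X : Type} (d : X -> X -> R) : Prop :=
  (forall x y, d x y = 0 <-> x = y) /\ (forall x y, d x y = d y x) /\
  (forall x y z, d x z <= d x y + d y z).

Definition is_geodesic {R : realType} {X : Type} (d : X -> X -> R) (c : R -> X) : Prop :=
  forall s t, d (c s) (c t) = `|s - t|.

Definition is_ray {R : realType} {X : Type} (d : X -> X -> R) (r : R -> X) : Prop :=
  forall s t, 0 <= s -> 0 <= t -> d (r s) (r t) = `|s - t|.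

Definition is_segment {R : realType} {X : Type} (d : X -> X -> R) (g : R -> X) (s t : R) : Prop :=
  s <= t /\ forall u v, s <= u <= t -> s <= v <= t -> d (g u) (g v) = `|u - v|.

(* asymptotic rays: bounded distance along [0, +oo); defines equality of ideal points *)
Definition asymptotic {R : realType} {X : Type} (d : X -> X -> R) (r1 r2 : R -> X) : Prop :=
  exists K : R, forall t, 0 <= t -> d (r1 t) (r2 t) <= K.

Definition bwd {R : realType} {X : Type} (c : R -> X) : R -> X := fun t => c (- t).

(* c1(+oo) = c2(+oo) and c1(-oo) = c2(-oo) *)
Definition same_plus {R : realType} {X : Type} (d : X -> X -> R) (c1 c2 : R -> X) : Prop :=
  asymptotic d c1 c2.
Definition same_minus {R : realType} {X : Type} (d : X -> X -> R) (c1 c2 : R -> X) : Prop :=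
  asymptotic d (bwd c1) (bwd c2).

Definition geodesic_space {R : realType} {X : Type} (d : X -> X -> R) : Prop :=
  forall x y, exists g, is_segment d g 0 (d x y) /\ g 0 = x /\ g (d x y) = y.

(* CAT(0): geodesic space in which, for every geodesic triangle, the distance from a
   vertex to a point of the opposite side is at most the comparison (Euclidean) one. *)
Definition CAT0 {R : realType} {X : Type} (d : X -> X -> R) : Prop :=
  geodesic_space d /\
  forall x y z g, is_segment d g 0 (d y z) -> g 0 = y -> g (d y z) = z ->
    forall t, 0 <= t <= 1 ->
      d x (g (t * d y z)) ^+ 2 <=
        (1 - t) * d x y ^+ 2 + t * d x z ^+ 2 - t * (1 - t) * d y z ^+ 2.

Definition geodesically_complete {R : realType} {X : Type} (d : X -> X -> R) : Prop :=
  forall g s t, s < t -> is_segment d g s t ->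
    exists c, is_geodesic d c /\ forall u, s <= u <= t -> c u = g u.

Definition metric_locally_compact {R : realType} {X : Type} (d : X -> X -> R) : Prop :=
  forall x, exists r : R, 0 < r /\
    forall u : nat -> X, (forall n, d x (u n) <= r) ->
      exists (phi : nat -> nat) (y : X), (forall n, (phi n < phi n.+1)%N) /\
        (fun n => d (u (phi n)) y) @ \oo --> (0 : R).

(* Cone topology on the boundary, realised on the rays issuing from a base point o. *)
Definition ray_from {R : realType} {X : Type} (d : X -> X -> R) (o : X) (r : R -> X) : Prop :=
  is_ray d r /\ r 0 = o.

Definition cone_open {R : realType} {X : Type} (d : X -> X -> R) (o : X)
  (U : (R -> X) -> Prop) : Prop :=
  (forall r, U r -> ray_from d o r) /\
  forall r, U r -> exists Rr e : R, 0 < Rr /\ 0 < e /\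
    forall r', ray_from d o r' -> d (r Rr) (r' Rr) < e -> U r'.

Definition cone_connected {R : realType} {X : Type} (d : X -> X -> R) (o : X) : Prop :=
  ~ exists U V, cone_open d o U /\ cone_open d o V /\
      (exists r, U r) /\ (exists r, V r) /\ (forall r, ~ (U r /\ V r)) /\
      (forall r, ray_from d o r -> U r \/ V r).

Definition connected_at_infinity {R : realType} {X : Type} (d : X -> X -> R) : Prop :=
  exists o, cone_connected d o.

(* c virtually bounds a flat strip: there is a geodesic with the same two ideal
   endpoints and a different image (hence a flat strip of positive width around c). *)
Definition virtually_bounds_flat_strip {R : realType} {X : Type} (d : X -> X -> R)
  (c : R -> X) : Prop :=
  exists c', is_geodesic d c' /\ same_plus d c c' /\ same_minus d c c' /\
    exists t, forall s, c' t <> c s.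

Definition strictly_rank_one {R : realType} {X : Type} (d : X -> X -> R) (c : R -> X) : Prop :=
  ~ virtually_bounds_flat_strip d c.

Definition busemann {R : realType} {X : Type} (d : X -> X -> R) (rho : R -> X) (y : X) : R :=
  lim ((d y (rho t) - t) @[t --> +oo]).

(* metric transfer R_{c1 c2} (relation p |-> q), the common endpoint being rho(+oo) *)
Definition transfer {R : realType} {X : Type} (d : X -> X -> R) (rho c1 c2 : R -> X)
  (p q : X) : Prop :=
  exists t s, p = c1 t /\ q = c2 s /\ busemann d rho (c2 s) = busemann d rho (c1 t).

Definition scissors {R : realType} {X : Type} (d : X -> X -> R) (a b c e : R -> X) (x : X) : Prop :=
  [/\ is_geodesic d a, is_geodesic d b, is_geodesic d c & is_geodesic d e] /\
  [/\ same_minus d a b, same_plus d a c, same_minus d c e & same_plus d b e] /\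
  (exists t, b t = x) /\ (exists s, c s = x) /\ (forall t s, b t = c s -> b t = x).

Definition scissors_translation {R : realType} {X : Type} (d : X -> X -> R) (a b c e : R -> X)
  (m m4 : X) : Prop :=
  exists m1 m2 m3, transfer d a a c m m1 /\ transfer d (bwd c) c e m1 m2 /\
    transfer d e e b m2 m3 /\ transfer d (bwd b) b a m3 m4.

(* the ideal point of the ray r' from r 0 asymptotic to c lies in the basic
   cone neighbourhood U(r, Rr, e) of r(+oo) *)
Definition in_cone_nbhd {R : realType} {X : Type} (d : X -> X -> R) (r : R -> X) (Rr e : R)
  (c : R -> X) : Prop :=
  exists r', ray_from d (r 0) r' /\ asymptotic d r' c /\ d (r Rr) (r' Rr) < e.

(* Main.v *)
(** Busemann functions are 1-Lipschitz and have slope -1 along geodesics ending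
at their centre, so the displacement is at most 2 (d (x, x0) + d (q, x)) for any
q on the fourth blade e. It remains to find q on e close to x0 = a(t0). If e stays
at distance at least r from x0, choose q on e no farther than x0 from e(S) and from
e(-S); the point p at distance r from x0 on [x0, q] inherits this property by
convexity, and the CAT(0) inequality turns it into
d (p, a(t0 +- N)) <= N + O(1/N). Compactness of a small sphere around x0 gives, as
N grows, a limit point p <> x0 lying in both closed horoballs of a whose
horospheres pass through x0. The midpoints of p and a(t0 + 2s) then trace a
geodesic parallel to a and different from it, against the rank one assumption. *)
Require Import Defs.
From HB Require Import structures.
From mathcomp Require Import all_boot all_order all_algebra.
From mathcomp Require Import all_classical all_reals all_analysis.
From mathcomp Require Import ring lra.
Import Order.TTheory GRing.Theory Num.Theory.
Import numFieldNormedType.Exports.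
Local Open Scope ring_scope.

Set Implicit Arguments.
Unset Strict Implicit.

Section CAT0Geometry.
Context {R : realType} {X : Type} (d : X -> X -> R).
Context (dM : is_metric d) (dC : CAT0 d).

(** * Division points and convexity of the metric *)

Lemma dxx x : d x x = 0.
Proof. by case: dM => h _; apply/h. Qed.

Lemma dsym x y : d x y = d y x.
Proof. by case: dM => _ [h _]. Qed.

Lemma dtri y x z : d x z <= d x y + d y z.
Proof. by case: dM => _ [_ h]. Qed.

Lemma d_ge0 x y : 0 <= d x y.
Proof. by have := dtri y x x; rewrite dxx (dsym y x); lra. Qed.

(** A relation, so that points of a given geodesic and freely chosen points are treated alike. *)
Definition divides x y (t : R) m :=
  exists g, [/\ is_segment d g 0 (d x y), g 0 = x, g (d x y) = y & m = g (t * d x y)].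

Lemma divides_exists x y (t : R) : exists m, divides x y t m.
Proof.
have [g [? [? ?]]] := dC.1 x y.
by exists (g (t * d x y)), g; split.
Qed.

Lemma divides_CAT0 z x y (t : R) m : 0 <= t <= 1 -> divides x y t m ->
  d z m ^+ 2 <= (1 - t) * d z x ^+ 2 + t * d z y ^+ 2 - t * (1 - t) * d x y ^+ 2.
Proof. by move=> t01 [g [gs g0 gl ->]]; exact: dC.2. Qed.

Lemma divides_dl x y (t : R) m : 0 <= t <= 1 -> divides x y t m -> d x m = t * d x y.
Proof.
move=> /andP[t0 t1] [g [[_ gs] g0 _ ->]]; have D0 := d_ge0 x y.
have tD : 0 <= t * d x y <= d x y by rewrite mulr_ge0//= ler_piMl.
have D00 : (0 : R) <= 0 <= d x y by rewrite lexx D0.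
by rewrite -{1}g0 (gs _ _ D00 tD) sub0r normrN ger0_norm//; case/andP: tD.
Qed.

Lemma geodesic_divides c u v t : is_geodesic d c ->
  divides (c u) (c v) t (c ((1 - t) * u + t * v)).
Proof.
move=> cg; rewrite /divides (cg u v); have [uv|vu] := leP u v.
- exists (fun w => c (u + w)); rewrite ler0_norm ?subr_le0//; split.
  + split; first lra.
    by move=> p q _ _; rewrite cg; congr `|_|; lra.
  + by congr c; lra.
  + by congr c; lra.
  + by congr c; lra.
- exists (fun w => c (u - w)); rewrite gtr0_norm ?subr_gt0//; split.
  + split; first lra.
    by move=> p q _ _; rewrite cg distrC; congr `|_|; lra.
  + by congr c; lra.
  + by congr c; lra.
  + by congr c; lra.
Qed.

Lemma ray_divides r S t : is_ray d r -> 0 <= S ->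
  divides (r 0) (r S) t (r (t * S)).
Proof.
move=> rr S0; exists r; rewrite rr// sub0r normrN ger0_norm//; split=> //.
by split=> // u v /andP[? _] /andP[? _]; exact: rr.
Qed.

(** The squared right side is the CAT(0) bound with [d x y] replaced by [d z x - d z y], whose
    absolute value is at most [d x y]. *)
Lemma divides_convex z x y (t : R) m : 0 <= t <= 1 -> divides x y t m ->
  d z m <= (1 - t) * d z x + t * d z y.
Proof.
move=> t01 h; have D1 := divides_CAT0 z t01 h.
have := dtri x z y; have := dtri z x y; have := dtri y z x.
rewrite (dsym y x) (dsym x z).
have := d_ge0 z x; have := d_ge0 z y; have := d_ge0 z m.
move: D1; set A := d z x; set B := d z y; set C := d x y; set M := d z m.
move=> D1 M0 B0 A0 h1 h2 h3.
have AB : (A - B) ^+ 2 <= C ^+ 2 by nra.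
have t1 : 0 <= t * (1 - t) by nra.
rewrite -(@ler_pXn2r _ 2%N)// ?nnegrE//; first by nra.
by apply: addr_ge0; apply: mulr_ge0 => //; lra.
Qed.

(** CAT(0) is applied to [y'] against [m], then to [m] against [m']; everything cancels except
    [t^2 * d y y'^2]. *)
Lemma divides_contract x y y' (t : R) m m' : 0 <= t <= 1 ->
  divides x y t m -> divides x y' t m' -> d m m' <= t * d y y'.
Proof.
move=> t01 h h'.
have E1 := divides_CAT0 y' t01 h; have E2 := divides_CAT0 m t01 h'.
have E3 := divides_dl t01 h.
rewrite (dsym m x) E3 (dsym m y') in E2; rewrite (dsym y' x) (dsym y' y) in E1.
rewrite -(@ler_pXn2r _ 2%N)// ?nnegrE ?d_ge0//; last first.
  by apply: mulr_ge0; [lra|exact: d_ge0].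
move: E1 E2.
set a1 := d y' m; set A := d x y; set B := d x y'; set C := d y y' => E1 E2.
have : t * a1 ^+ 2 <=
   t * ((1 - t) * B ^+ 2 + t * C ^+ 2 - t * (1 - t) * A ^+ 2).
  by apply: ler_wpM2l => //; lra.
rewrite exprMn in E2 *; lra.
Qed.

(** * Reparametrised geodesics and common ideal endpoints *)

Lemma geodesic_shift c u : is_geodesic d c -> is_geodesic d (fun t => c (u + t)).
Proof. by move=> cg s t; rewrite cg; congr `|_|; lra. Qed.

Lemma geodesic_bwd c : is_geodesic d c -> is_geodesic d (bwd c).
Proof. by move=> cg s t; rewrite /bwd cg distrC; congr `|_|; lra. Qed.

Lemma geodesic_inj c s t : is_geodesic d c -> c s = c t -> s = t.
Proof.
by move=> cg e; apply/eqP; rewrite -subr_eq0 -normr_eq0 -cg e dxx.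
Qed.

Lemma asymptotic_sym r1 r2 : asymptotic d r1 r2 -> asymptotic d r2 r1.
Proof. by move=> [K h]; exists K => t /h; rewrite dsym. Qed.

Lemma asymptotic_trans r2 r1 r3 :
  asymptotic d r1 r2 -> asymptotic d r2 r3 -> asymptotic d r1 r3.
Proof.
move=> [K h] [L h']; exists (K + L) => t t0.
by rewrite (le_trans (dtri (r2 t) _ _))// lerD ?h ?h'.
Qed.

(** * Busemann functions *)

(** By the triangle inequality [t - d y (rho t)] is nondecreasing and at most [d y (rho 0)], so it
    converges to its supremum. *)
Lemma busemann_cvg rho y : is_geodesic d rho ->
  (d y (rho t) - t @[t --> +oo] --> busemann d rho y)%classic
  /\ forall T, busemann d rho y <= d y (rho T) - T.
Proof.
move=> rg; set f := fun t => t - d y (rho t).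
have ndf : {homo f : s t / s <= t}.
  move=> s t st; rewrite /f; have := dtri (rho s) y (rho t).
  by rewrite rg distrC ger0_norm ?subr_ge0//; lra.
have ubf : has_ubound (range f).
  exists (d y (rho 0)) => _ [t _ <-]; rewrite /f.
  have := dtri y (rho 0) (rho t); rewrite rg sub0r normrN (dsym (rho 0)).
  by have := ler_norm t; lra.
have cf := nondecreasing_cvgr ndf ubf.
have cg : (d y (rho t) - t @[t --> +oo] --> - sup (range f))%classic.
  rewrite (_ : (fun t => d y (rho t) - t) = - f); first exact: cvgN.
  by apply/funext => t; apply: esym; exact: opprB.
have be : busemann d rho y = - sup (range f) by exact/cvg_lim.
rewrite be; split=> // T.
have : f T <= sup (range f) by apply: ub_le_sup => //; exists T.
by rewrite /f; lra.
Qed.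

Lemma busemann_approx rho y (eps : R) : is_geodesic d rho -> 0 < eps ->
  exists T0, forall T, T0 <= T -> d y (rho T) - T < busemann d rho y + eps.
Proof.
move=> rg e0; have [cb _] := busemann_cvg y rg.
have /(_ _) := cvgr_lt _ cb (busemann d rho y + eps).
move=> /(_ ltac:(lra)) [M [_ h]]; exists (M + 1) => T MT; apply: h; lra.
Qed.

Lemma busemann_lipschitz rho y z : is_geodesic d rho ->
  busemann d rho y - busemann d rho z <= d y z.
Proof.
move=> rg; apply/ler_addgt0Pr => e e0.
have [T0 /(_ T0 (lexx _)) h] := busemann_approx z rg e0.
have [_ /(_ T0)] := busemann_cvg y rg.
by have := dtri z y (rho T0); lra.
Qed.

Lemma busemann_convex rho y z (t : R) m : is_geodesic d rho -> 0 <= t <= 1 ->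
  divides y z t m ->
  busemann d rho m <= (1 - t) * busemann d rho y + t * busemann d rho z.
Proof.
move=> rg /[dup] t01 /andP[t0 t1] h; apply/ler_addgt0Pr => e e0.
have [Ty hy] := busemann_approx y rg e0.
have [Tz hz] := busemann_approx z rg e0.
set T := Num.max Ty Tz.
have {}hy := hy T ltac:(by rewrite le_max lexx).
have {}hz := hz T ltac:(by rewrite le_max lexx orbT).
have [_ /(_ T) hm] := busemann_cvg m rg.
have := divides_convex (rho T) t01 h; rewrite !(dsym (rho T)) => hc.
have : (1 - t) * (d y (rho T) - T) <= (1 - t) * (busemann d rho y + e).
  by apply: ler_wpM2l; [lra|exact: ltW].
have : t * (d z (rho T) - T) <= t * (busemann d rho z + e).
  by apply: ler_wpM2l; [lra|exact: ltW].
lra.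
Qed.

(* [busemann d rho (c s) + s] is nondecreasing, convex in [s] and bounded as
   [s --> +oo], hence constant. *)
Lemma busemann_asymptotic rho c s t : is_geodesic d rho -> is_geodesic d c ->
  asymptotic d rho c -> busemann d rho (c s) + s = busemann d rho (c t) + t.
Proof.
move=> rg cg [K hK]; wlog st : s t / s < t.
  by move=> W; case: (ltgtP s t) => [/W//|/W/esym//|->].
set h := fun u => busemann d rho (c u) + u.
have hnd u v : u <= v -> h u <= h v.
  move=> uv; have := busemann_lipschitz (c u) (c v) rg.
  by rewrite cg distrC ger0_norm ?subr_ge0// /h; lra.
have hub u : 0 <= u -> h u <= K.
  move=> u0; have [_ /(_ u)] := busemann_cvg (c u) rg.
  by have := hK u u0; rewrite dsym /h; lra.
have [hts|hst] := leP (h t) (h s).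
  by apply/le_anti/andP; split=> //; exact/hnd/ltW.
exfalso.
pose D := h t - h s; have D0 : 0 < D by rewrite /D; lra.
(* Convexity forces [h T >= h s + D * (T - s) / (t - s)]; this [T] is large enough for that to
   exceed [K]. *)
pose T := Num.max 0 t + (t - s) * `|K - h s| / D + 1.
have q0 : 0 <= (t - s) * `|K - h s| / D.
  by rewrite divr_ge0 ?mulr_ge0// ?ltW// subr_gt0.
have m0 : 0 <= Num.max 0 t by rewrite le_max lexx.
have mt : t <= Num.max 0 t by rewrite le_max lexx orbT.
have T0 : 0 <= T by rewrite /T; lra.
have Tt : t < T by rewrite /T; lra.
have Ts : 0 < T - s by lra.
pose l := (t - s) / (T - s).
have l01 : 0 <= l <= 1.
  apply/andP; split; first by apply: divr_ge0; lra.
  by rewrite /l ler_pdivrMr// mul1r; lra.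
have lE : l * (T - s) = t - s by rewrite /l divfK// gt_eqF.
have := busemann_convex rg l01 (geodesic_divides s T l cg).
rewrite (_ : (1 - l) * s + l * T = t); last by lra.
move=> hc.
have hl : D <= l * (h T - h s).
  have -> : l * (h T - h s) = l * busemann d rho (c T) -
     l * busemann d rho (c s) + l * (T - s) by rewrite /h; lra.
  by rewrite lE /D /h; lra.
have hl' : D <= l * `|K - h s|.
  apply: (le_trans hl); apply: ler_wpM2l; first by case/andP: l01.
  by have := hub _ T0; have := ler_norm (K - h s); lra.
have : D * (T - s) <= (t - s) * `|K - h s|.
  have : D * (T - s) <= l * `|K - h s| * (T - s) by apply: ler_wpM2r; lra.
  by rewrite -lE; lra.
have : D * ((t - s) * `|K - h s| / D + 1) <= D * (T - s).
  by apply: ler_wpM2l; [lra|rewrite /T; lra].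
rewrite mulrDr mulrC divfK ?gt_eqF//; lra.
Qed.

(** By the slope -1 along both geodesics, the difference of offsets equals the Busemann difference
    of the marked points [c1 t1] and [c2 s1]. *)
Lemma transfer_error rho c1 c2 t s t1 s1 :
  is_geodesic d rho -> is_geodesic d c1 -> is_geodesic d c2 ->
  asymptotic d rho c1 -> asymptotic d rho c2 ->
  busemann d rho (c2 s) = busemann d rho (c1 t) ->
  `|(t - t1) - (s - s1)| <= d (c1 t1) (c2 s1).
Proof.
move=> rg g1 g2 a1 a2 e.
have := busemann_asymptotic t t1 rg g1 a1.
have := busemann_asymptotic s s1 rg g2 a2.
have := busemann_lipschitz (c1 t1) (c2 s1) rg.
have := busemann_lipschitz (c2 s1) (c1 t1) rg.
rewrite (dsym (c2 s1)) ler_norml => *; apply/andP; split; lra.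
Qed.

(** * Rank one geodesics and the horoballs at their two ends *)

(** For a geodesic [a], both Busemann functions of [a] vanishing at [a 0] are at most 0 at [p], in
    the form that a compactness argument yields. *)
Definition in_both_horoballs (a : R -> X) p := forall eps T0 : R, 0 < eps ->
  exists T, [/\ T0 <= T, d p (a T) <= T + eps & d p (a (- T)) <= T + eps].

(** Contraction by one half gives the upper bound. For the lower one, the path [a (- T)], [c t],
    [c s], [a T] has length at least [2 * T], while convexity bounds its outer legs by [T + t] and
    [T - s] up to a small error. *)
Lemma midpoints_geodesic a p c : is_geodesic d a -> in_both_horoballs a p ->
  (forall s, divides p (a (2 * s)) 2^-1 (c s)) -> is_geodesic d c.
Proof.
move=> ag ap cm; have h01 : 0 <= (2^-1 : R) <= 1 by lra.
have key s t : s - t <= d (c s) (c t).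
  apply/ler_addgt0Pr => e e0.
  have [T [TT hp hm]] := ap _ (2 * `|s| + 2 * `|t|) e0.
  have := divides_convex (a T) h01 (cm s).
  have := divides_convex (a (- T)) h01 (cm t).
  have := dtri (c t) (a (- T)) (a T); have := dtri (c s) (c t) (a T).
  have := ler_norm s; have := ler_norm (- t); rewrite normrN.
  have := normr_ge0 s; have := normr_ge0 t => t0 s0 ht hs.
  have n1 : `|- T - T| = 2 * T by rewrite ler0_norm; lra.
  have n2 : `|- T - 2 * t| = T + 2 * t by rewrite ler0_norm; lra.
  have n3 : `|T - 2 * s| = T - 2 * s by rewrite ger0_norm; lra.
  rewrite !ag n1 n2 n3 (dsym (c t) (c s)) (dsym (c t)) (dsym (a (- T)) p).
  rewrite (dsym (a T) p) (dsym (a T) (c s)) (dsym (a (- T)) (c t)); lra.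
move=> s t; apply/eqP; rewrite eq_le; apply/andP; split.
  have := divides_contract h01 (cm s) (cm t).
  by rewrite ag -mulrBr normrM ger0_norm// mulrA mulVf// mul1r.
have := key s t; have := key t s; rewrite (dsym (c t)) ler_norml => *; apply/andP; split; lra.
Qed.

(** The geodesic of midpoints is parallel to [a], so rank one puts [c 0] on [a]. The horoball bounds
    then give [c 0 = a 0], and [a 0] is its own midpoint with [p]. *)
Lemma horoballs_meet a p : is_geodesic d a -> strictly_rank_one d a ->
  in_both_horoballs a p -> p = a 0.
Proof.
move=> ag ar ap; have h01 : 0 <= (2^-1 : R) <= 1 by lra.
have [c cm] := choice (fun s => divides_exists p (a (2 * s)) 2^-1).
have cg := midpoints_geodesic ag ap cm.
have near s : d (a s) (c s) <= d p (a 0).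
  have am := geodesic_divides 0 (2 * s) 2^-1 ag.
  have E1 := divides_CAT0 (c s) h01 am.
  have E2 := divides_CAT0 (a 0) h01 (cm s).
  have E3 := divides_CAT0 (a (2 * s)) h01 (cm s).
  rewrite (_ : (1 - 2^-1) * 0 + 2^-1 * (2 * s) = s) in E1; last by lra.
  rewrite dxx expr0n /= in E3.
  rewrite (dsym (a s)) (dsym p (a 0)) -(@ler_pXn2r _ 2%N) ?nnegrE ?d_ge0//.
  rewrite (dsym (c s) (a 0)) (dsym (c s) (a (2 * s))) in E1.
  rewrite (dsym (a (2 * s)) p) in E3.
  have := sqr_ge0 (d (a 0) p); lra.
have [u cu] : exists u, c 0 = a u.
  apply: contrapT => nu; apply: ar; exists c; split=> //; split; last split.
  - by exists (d p (a 0)) => t _; exact: near.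
  - by exists (d p (a 0)) => t _; exact: near.
  - by exists 0 => s e; apply: nu; exists s.
have u0 : u = 0.
  suff : `|u| <= 0 by rewrite normr_le0 => /eqP.
  apply/ler_addgt0Pr => e e0; rewrite add0r.
  have [T [TT hp hm]] := ap _ `|u| e0.
  have := divides_convex (a T) h01 (cm 0).
  have := divides_convex (a (- T)) h01 (cm 0).
  have := ler_norm u; have := ler_norm (- u); rewrite normrN.
  have := normr_ge0 u => hu hu1 hu2.
  have n1 : `|- T - u| = T + u by rewrite ler0_norm; lra.
  have n2 : `|T - u| = T - u by rewrite ger0_norm; lra.
  have n3 : `|- T - 0| = T by rewrite ler0_norm; lra.
  have n4 : `|T - 0| = T by rewrite ger0_norm; lra.
  rewrite cu mulr0 !ag (dsym (a (- T)) p) (dsym (a T) p) n1 n2 n3 n4 => k1 k2.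
  by rewrite ler_norml; apply/andP; split; lra.
have := cm 0; rewrite cu u0 mulr0 => /(divides_dl h01) e.
by case: dM => h _; apply/h; have := d_ge0 p (a 0); lra.
Qed.

Lemma strictly_rank_one_shift a u : is_geodesic d a -> strictly_rank_one d a ->
  strictly_rank_one d (fun t => a (u + t)).
Proof.
move=> ag ar [c [cg [cp [cm [t ct]]]]]; apply: ar; exists c; split=> //.
split; last split.
- apply: asymptotic_trans cp; exists `|u| => s _; rewrite ag.
  by rewrite opprD addrCA subrr addr0 normrN.
- apply: asymptotic_trans cm; exists `|u| => s _; rewrite /bwd ag.
  by rewrite opprD addrCA subrr addr0 normrN.
- by exists t => s e; apply: (ct (s - u)); rewrite addrC subrK.
Qed.

(** * Geodesics whose ends are close to those of a rank one geodesic *)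

(* The gap between [d p y <= d (r 0) y] and the conclusion is second order in
   the distance from [p] to [r 0]: this is what makes the error vanish as
   [N] and [S / N] grow. *)
Lemma ray_estimate r p y (N S K : R) : is_ray d r -> 0 < N -> N <= S ->
  d (r S) y <= K -> d p y <= d (r 0) y ->
  d p (r N) <= N + 2 * (N / S) * K + d p (r 0) ^+ 2 / (2 * N).
Proof.
move=> rr N0 NS yK py; have S0 : 0 < S by lra.
pose t := N / S; have tS : t * S = N by rewrite /t divfK// gt_eqF.
have t0 : 0 < t by rewrite divr_gt0.
have t01 : 0 <= t <= 1.
  by rewrite (ltW t0)/= /t ler_pdivrMr// mul1r.
(* [m] stands in for [r N], at distance at most [t * K], because the hypothesis on [p] concerns
   [y]. *)
have [m hm] := divides_exists (r 0) y t.
have rm := ray_divides t rr (ltW S0); rewrite tS in rm.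
have mr := divides_contract t01 hm rm; rewrite (dsym y) in mr.
have pm := divides_CAT0 p t01 hm.
have pr := dtri m p (r N).
have yr : t * d (r 0) y <= N + t * K.
  rewrite -tS -mulrDr ler_wpM2l ?(ltW t0)//.
  have := dtri (r S) (r 0) y; rewrite (rr _ _ (lexx 0) (ltW S0)) sub0r normrN gtr0_norm//; lra.
have tyK : t * d (r S) y <= t * K by rewrite ler_wpM2l ?(ltW t0).
have K0 : 0 <= K by apply: le_trans yK; exact: d_ge0.
have tK0 : 0 <= t * K by rewrite mulr_ge0 ?(ltW t0).
have sq : d p m ^+ 2 <= d p (r 0) ^+ 2 + (N + t * K) ^+ 2.
  have h1 : t * d p y ^+ 2 <= t * d (r 0) y ^+ 2.
    by rewrite ler_wpM2l ?(ltW t0)// ler_sqr ?nnegrE ?d_ge0.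
  have h2 : (t * d (r 0) y) ^+ 2 <= (N + t * K) ^+ 2.
    have b0 : 0 <= t * d (r 0) y by rewrite mulr_ge0 ?d_ge0 ?(ltW t0).
    have NK0 : 0 <= N + t * K by lra.
    by rewrite ler_sqr ?nnegrE.
  have h3 : 0 <= t * d p (r 0) ^+ 2 by rewrite mulr_ge0 ?sqr_ge0 ?(ltW t0).
  rewrite exprMn in h2; lra.
(* Chosen with [2 * N * w = d p (r 0)^2], so that [(N + t * K + w)^2] dominates the bound [sq]. *)
set w := d p (r 0) ^+ 2 / (2 * N).
have w0 : 0 <= w by rewrite divr_ge0 ?sqr_ge0//; lra.
have wN : d p (r 0) ^+ 2 = 2 * N * w by rewrite /w mulrC divfK// gt_eqF//; lra.
have : d p m <= N + t * K + w.
  rewrite -(@ler_pXn2r _ 2%N) ?nnegrE ?d_ge0//; last lra.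
  have : 0 <= 2 * (t * K) * w by rewrite mulr_ge0//; lra.
  have := sqr_ge0 w; lra.
rewrite -/t; lra.
Qed.

(** Otherwise counterexamples for [N = n + 1] subconverge to a point of the sphere; as [C / N] tends
    to 0, it lies in both horoballs, hence equals the centre. *)
Lemma sphere_gap a (r C : R) : is_geodesic d a -> strictly_rank_one d a -> 0 < r ->
  (forall u : nat -> X, (forall n, d (a 0) (u n) <= r) ->
      exists (phi : nat -> nat) (y : X), (forall n, (phi n < phi n.+1)%N) /\
        (fun n => d (u (phi n)) y) @ \oo --> (0 : R))%classic ->
  exists N : R, 0 < N /\ forall p, d (a 0) p = r ->
    d p (a N) <= N + C / N -> d p (a (- N)) <= N + C / N -> False.
Proof.
move=> ag ar r0 cpt; apply: contrapT => ngap.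
have /choice[u hu] : forall n : nat, exists p, [/\ d (a 0) p = r,
    d p (a n.+1%:R) <= n.+1%:R + C / n.+1%:R &
    d p (a (- n.+1%:R)) <= n.+1%:R + C / n.+1%:R].
  move=> n; apply: contrapT => np; apply: ngap; exists n.+1%:R; split=> // p p1 p2 p3.
  by apply: np; exists p.
have [phi [p [phiS up]]] := cpt u ltac:(by move=> n; case: (hu n) => ->).
have phi_ge n : (n <= phi n)%N.
  by elim: n => // n IH; exact: leq_ltn_trans (phiS n).
have close (e : R) : 0 < e -> exists n0, forall n, (n0 <= n)%N -> d (u (phi n)) p < e.
  move=> e0; have [n0 _ h] := cvgr_lt _ up e e0.
  by exists n0 => n nn; exact: h.
suff pa : p = a 0.
  have [n0 /(_ n0 (leqnn _))] := close r r0.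
  by have [] := hu (phi n0) => h _ _; rewrite pa (dsym _ (a 0)) h ltxx.
apply: horoballs_meet => // e T0 e0.
have e20 : 0 < e / 2 by lra.
have [n0 hn0] := close _ e20.
pose A : R := `|T0| + `|C| / (e / 2).
pose n1 := Num.truncn A.
have A0 : 0 <= A by rewrite addr_ge0// divr_ge0// ltW.
pose n := maxn n0 n1; pose M := (phi n).+1%:R : R.
have MA : A < M.
  have := truncnS_gt A => h; apply: (lt_le_trans h); rewrite ler_nat ltnS.
  by apply: leq_trans (phi_ge n); rewrite leq_maxr.
have M0 : 0 < M by rewrite ltr0n.
have q0 : 0 <= `|C| / (e / 2) by rewrite divr_ge0// ltW.
have CM : C / M <= e / 2.
  rewrite ler_pdivrMr// (le_trans (ler_norm C))// -ler_pdivrMl//.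
  by rewrite mulrC; have := normr_ge0 T0; rewrite /A in MA; lra.
have MCM : M + C / M <= M + e / 2 by rewrite lerD2l.
have [_ /le_trans/(_ MCM) h1 /le_trans/(_ MCM) h2] := hu (phi n).
have hp := hn0 n (leq_maxl _ _).
exists M; split.
- by have := ler_norm T0; rewrite /A in MA; lra.
- by have := dtri (u (phi n)) p (a M); rewrite (dsym p (u _)); lra.
- by have := dtri (u (phi n)) p (a (- M)); rewrite (dsym p (u _)); lra.
Qed.

Lemma rank_one_attracts a (r : R) : metric_locally_compact d ->
  is_geodesic d a -> strictly_rank_one d a -> 0 < r ->
  exists N delta : R, [/\ 0 < N, 0 < delta & forall e, is_geodesic d e ->
    in_cone_nbhd d a N delta e -> in_cone_nbhd d (bwd a) N delta (bwd e) ->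
    exists u, d (e u) (a 0) < r].
Proof.
move=> lc ag ar r0; have [rb [rb0 cpt]] := lc (a 0).
pose s := Num.min r rb.
have s0 : 0 < s by rewrite lt_min r0.
have [sr srb] : s <= r /\ s <= rb by rewrite !ge_min !lexx orbT.
(* In [2 + s^2], one unit pays for the cone radius [1 / N], one for the asymptoticity constants, and
   [s^2] for the quadratic term of [ray_estimate]. *)
have [N [N0 gap]] := @sphere_gap a s (2 + s ^+ 2) ag ar s0
  (fun u us => cpt u (fun k => le_trans (us k) srb)).
exists N, N^-1; split=> //; first by rewrite invr_gt0.
move=> e eg [r1 [[r1r r10] [[K1 hK1] r1N]]] [r2 [[r2r r20] [[K2 hK2] r2N]]].
rewrite /bwd oppr0 in r20 r2N.
apply: contrapT => far.
have {}far u : s <= d (e u) (a 0).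
  by rewrite leNgt; apply/negP => h; apply: far; exists u; lra.
(* Makes [2 * (N / S) * K] at most [1 / N] for [K1] and [K2]. *)
pose S := N + 2 * N ^+ 2 * (`|K1| + `|K2|).
have N20 : 0 <= 2 * N ^+ 2 by rewrite mulr_ge0// sqr_ge0.
have k1 : 0 <= 2 * N ^+ 2 * `|K1| by rewrite mulr_ge0.
have k2 : 0 <= 2 * N ^+ 2 * `|K2| by rewrite mulr_ge0.
have NS : N <= S by rewrite /S; lra.
have S0 : 0 < S by lra.
have small K : 2 * N ^+ 2 * `|K| <= S -> 2 * (N / S) * K <= N^-1.
  move=> h; rewrite -(ler_pM2r N0) mulVf ?gt_eqF// -(ler_pM2r S0) mul1r.
  have -> : 2 * (N / S) * K * N * S = 2 * N ^+ 2 * K.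
    by field; rewrite gt_eqF.
  by apply: le_trans h; rewrite ler_wpM2l// ler_norm.
have g1 := small K1 ltac:(rewrite /S; lra).
have g2 := small K2 ltac:(rewrite /S; lra).
(* [q] is as far from [e S] as [a 0] is; the triangle inequality then controls its distance to
   [e (- S)]. *)
pose q := e (S - d (a 0) (e S)).
have qS : d q (e S) <= d (a 0) (e S).
  rewrite eg (_ : _ - _ = - d (a 0) (e S)); last lra.
  by rewrite normrN ger0_norm ?d_ge0.
have n1 : d (e S) (e (- S)) = 2 * S by rewrite eg gtr0_norm; lra.
have qS' : d q (e (- S)) <= d (a 0) (e (- S)).
  have t1 := dtri (a 0) (e S) (e (- S)); have t2 := dtri (e (- S)) (a 0) (e S).
  rewrite (dsym (e (- S)) (e S)) n1 in t2; rewrite n1 (dsym (e S)) in t1.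
  have -> : d q (e (- S)) = `|2 * S - d (a 0) (e S)|.
    by rewrite /q eg; congr `|_|; lra.
  by rewrite ler_norml; apply/andP; split; lra.
have sq := far (S - d (a 0) (e S)); rewrite -/q (dsym q) in sq.
(* Places [p] on the sphere of radius [s]; [l <= 1] because [e] avoids the ball. *)
pose l := s / d (a 0) q.
have q0 : 0 < d (a 0) q by lra.
have l01 : 0 <= l <= 1.
  by apply/andP; split; [apply: divr_ge0; lra|rewrite /l ler_pdivrMr// mul1r].
have [p hp] := divides_exists (a 0) q l.
have ps := divides_dl l01 hp; rewrite /l divfK ?gt_eqF// in ps.
have conv z : d q z <= d (a 0) z -> d p z <= d (a 0) z.
  move=> qz; have := divides_convex z l01 hp.
  rewrite !(dsym z) => /le_trans; apply.
  have : l * d q z <= l * d (a 0) z by rewrite ler_wpM2l//; case/andP: l01.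
  lra.
have e1 := hK1 S (ltW S0); have e2 := hK2 S (ltW S0).
have := ray_estimate r1r N0 NS e1; have := ray_estimate r2r N0 NS e2.
rewrite r10 r20 => /(_ _ (conv _ qS')) h2 /(_ _ (conv _ qS)) h1.
rewrite (dsym p (a 0)) ps in h1 h2.
have sN : s ^+ 2 / (2 * N) <= s ^+ 2 * N^-1.
  rewrite invfM ler_wpM2l ?sqr_ge0// ler_piMl ?invr_ge0 ?ltW//.
  by rewrite invf_lt1//; lra.
apply: (gap p ps); rewrite mulrDl.
- by have := dtri (r1 N) p (a N); rewrite (dsym (r1 N)); lra.
- by have := dtri (r2 N) p (a (- N)); rewrite (dsym (r2 N)); lra.
Qed.

(** * Displacement of scissors *)

Lemma asymptotic_refl r : asymptotic d r r.
Proof. by exists 0 => t _; rewrite dxx. Qed.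

Lemma in_cone_nbhd_asymptotic r (N delta : R) c1 c2 : asymptotic d c1 c2 ->
  in_cone_nbhd d r N delta c1 -> in_cone_nbhd d r N delta c2.
Proof.
by move=> c12 [r' [? [rc ?]]]; exists r'; split=> //; split=> //;
  exact: asymptotic_trans c12.
Qed.

(* The four transfers are measured against the marked points [a ta], [x], [e u]
   and [x] again; each changes the position relative to them by at most the
   distance of two consecutive ones. *)
Lemma scissors_displacement a b c e x m m4 ta u :
  scissors d a b c e x -> scissors_translation d a b c e m m4 ->
  `|busemann d (bwd a) m4 - busemann d (bwd a) m| <=
    2 * (d x (a ta) + d (e u) x).
Proof.
move=> [[ag bg cg eg] [[ab ac ce be] [[v bv] [[w cw] _]]]].
move=> [m1 [m2 [m3 [[t1 [s1 [-> [-> E1]]]] [[t2 [s2 [E12 [-> E2]]]] [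
  [t3 [s3 [E23 [-> E3]]]] [t4 [s4 [E34 [-> E4]]]]]]]]]].
have bga := geodesic_bwd ag; have bgb := geodesic_bwd bg.
have bgc := geodesic_bwd cg; have bge := geodesic_bwd eg.
have e12 := geodesic_inj cg E12; have e23 := geodesic_inj eg E23.
have e34 := geodesic_inj bg E34; subst t2 t3 t4.
have {E1} := transfer_error ta w ag ag cg (asymptotic_refl _) ac E1.
rewrite cw (dsym _ x).
have E2' : busemann d (bwd c) (bwd e (- s2)) = busemann d (bwd c) (bwd c (- s1)).
  by rewrite /bwd !opprK.
have {E2 E2'} := transfer_error (- w) (- u) bgc bgc bge (asymptotic_refl _) ce E2'.
rewrite {1 2}/bwd !opprK cw (dsym x).
have {E3} := transfer_error u v eg eg bg (asymptotic_refl _) (asymptotic_sym be) E3.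
rewrite bv.
have E4' : busemann d (bwd b) (bwd a (- s4)) = busemann d (bwd b) (bwd b (- s3)).
  by rewrite /bwd !opprK.
have {E4 E4'} := transfer_error (- v) (- ta) bgb bgb bga (asymptotic_refl _)
  (asymptotic_sym ab) E4'.
rewrite {1 2}/bwd !opprK bv.
(* Turns the displacement into the parameter difference [s4 - t1], the sum of the four offsets just
   bounded. *)
have := busemann_asymptotic (- s4) (- t1) bga bga (asymptotic_refl _).
rewrite {2 4}/bwd !opprK => E.
rewrite !ler_norml => /andP[? ?] /andP[? ?] /andP[? ?] /andP[? ?].
by apply/andP; split; lra.
Qed.
End CAT0Geometry.

Unset Implicit Arguments.
Set Strict Implicit.

Theorem theorem11 (R : realType) (X : Type) (d : X -> X -> R) (a : R -> X) (t0 : R) :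
  is_metric d -> metric_locally_compact d -> CAT0 d -> geodesically_complete d ->
  connected_at_infinity d -> is_geodesic d a -> strictly_rank_one d a ->
  forall eps : R, 0 < eps ->
    exists R1 e1 R2 e2 rho : R,
      [/\ 0 < R1, 0 < e1, 0 < R2, 0 < e2 & 0 < rho] /\
      forall (b c e : R -> X) (x : X),
        scissors d a b c e x ->
        in_cone_nbhd d (fun t => a (t0 + t)) R1 e1 b ->
        in_cone_nbhd d (fun t => a (t0 - t)) R2 e2 (bwd c) ->
        d x (a t0) < rho ->
        forall m m4 : X, scissors_translation d a b c e m m4 ->
          `| busemann d (bwd a) m4 - busemann d (bwd a) m | < eps.
Proof.
(* With [x] and [e u] both within [eps / 8] of [a t0], the displacement is at most [6 * eps / 8]. *)
move=> dM lc dC _ _ ag ar eps eps0; have eps8 : 0 < eps / 8 by lra.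
have [N [delta [N0 delta0 H]]] := rank_one_attracts dM dC lc
  (geodesic_shift t0 ag) (strictly_rank_one_shift (u := t0) dM ag ar) eps8.
exists N, delta, N, delta, (eps / 8); split; first by split.
move=> b c e x sc cb cc xa m m4 sT.
have [[_ _ _ eg] [[_ _ ce be] _]] := sc.
(* The fourth blade shares its ends with [b] and [c], so it inherits their cone neighbourhoods. *)
have [u eu] := H e eg (in_cone_nbhd_asymptotic dM be cb)
  (in_cone_nbhd_asymptotic dM ce cc).
apply: le_lt_trans (scissors_displacement dM dC t0 u sc sT) _.
by have := dtri dM (a t0) (e u) x; rewrite addr0 (dsym dM (a t0) x) in eu *; lra.
Qed.
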